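(* Let $A_1,B_1,A_2,B_2,\phi_A,\phi_B\in\mathbb{R}$ satisfy $A_1=-B_1\neq 0$, $A_2=B_2>0$ and $\phi_A+\phi_B\in 2\pi\mathbb{Z}$. If $$\frac{A_2}{A_1}\sin(\phi_A)+\cos(\phi_A)\notin(0,2),$$ then all positively oriented orbitlike solutions of the Dirichlet problem with data $(A_1,A_2),(B_1,B_2),\phi_A,\phi_B$ are symmetric. If $$-\Big(\frac{A_2}{A_1}\sin(\phi_A)+\cos(\phi_A)\Big)\notin(0,2),$$ then all negatively oriented orbitlike solutions of this Dirichlet problem are symmetric.
   Context: Let $\mathbb{H}=\{(x_1,x_2)\in\mathbb{R}^2: x_2>0\}$ with the hyperbolic metric $(dx_1^2+dx_2^2)/x_2^2$. A smooth curve $\gamma=(\gamma_1,\gamma_2)$ in $\mathbb{H}$ is parametrized by hyperbolic arclength if $(\gamma_1')^2+(\gamma_2')^2=\gamma_2^2$. Its angle function $\phi$ is the smooth function (unique up to adding a constant in $2\pi\mathbb{Z}$) with $\gamma_1'=\gamma_2\cos(\phi)$, $\gamma_2'=\gamma_2\sin(\phi)$, and its hyperbolic curvature function is $\kappa_\gamma=\phi'+\cos(\phi)$. Curves are parametrized by hyperbolic arclength throughout. An orbitlike elastica is such a curve $\gamma:\mathbb{R}\to\mathbb{H}$ whose hyperbolic curvature function has the form $$\kappa_\gamma(s)=\pm\frac{2}{\sqrt{2-k^2}}\,\mathrm{dn}\Big(\frac{s+s_*}{\sqrt{2-k^2}},k\Big)$$ for some $k\in(0,1)$, $s_*\in\mathbb{R}$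 and some sign, where $\mathrm{dn}(\cdot,k)$ is Jacobi's elliptic function with modulus $k$. It is called positively (negatively) oriented if the sign is $+$ (respectively $-$), i.e. if its hyperbolic curvature is positive (negative). An orbitlike solution of the Dirichlet problem with data $(A_1,A_2),(B_1,B_2)\in\mathbb{H}$ and $\phi_A,\phi_B\in\mathbb{R}$ is an orbitlike elastica $\gamma$ together with a hyperbolic length $L>0$ such that $$\gamma(0)=(A_1,A_2),\quad \gamma(L)=(B_1,B_2),\quad e^{i\phi(0)}=e^{i\phi_A},\quad e^{i\phi(L)}=e^{i\phi_B}.$$ (The surface of revolution generated by rotating $\gamma$ about the $x_1$-axis is then a Willmore surface.) A solution is called symmetric if $\gamma_1(L/2+s)=-\gamma_1(L/2-s)$ and $\gamma_2(L/2+s)=\gamma_2(L/2-s)$ for all $s\in[0,L/2]$. *)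

(* Defs.v *)
From Stdlib Require Import Reals.
From Coquelicot Require Import Coquelicot.
Open Scope R_scope.

(** Jacobi's elliptic functions, with modulus [k] (not parameter [m = k ^ 2]). *)

Definition ellF (x k : R) : R :=
  RInt (fun t => / sqrt (1 - k ^ 2 * sin t ^ 2)) 0 x.

(* For |k| < 1 the map [ellF _ k] is an increasing bijection of R, so that the
   definite description below is its inverse. *)
Definition am (u k : R) : R := iota (fun x : R => ellF x k = u).

Definition dn (u k : R) : R := sqrt (1 - k ^ 2 * sin (am u k) ^ 2).

Definition smooth (f : R -> R) : Prop := forall (n : nat) (s : R), ex_derive_n f n s.

(** Smooth curves R -> H parametrized by hyperbolic arclength. *)
Record hcurve : Type := HCurve {
  x1 : R -> R;
  x2 : R -> R;
  x1_smooth : smooth x1;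
  x2_smooth : smooth x2;
  x2_pos : forall s, 0 < x2 s;
  arclength : forall s, Derive x1 s ^ 2 + Derive x2 s ^ 2 = x2 s ^ 2
}.

Definition angle_function (gamma : hcurve) (phi : R -> R) : Prop :=
  smooth phi /\
  forall s, Derive (x1 gamma) s = x2 gamma s * cos (phi s) /\
            Derive (x2 gamma) s = x2 gamma s * sin (phi s).

(* [phi] is an angle function of the curve; as it is unique up to a constant in
   2 pi Z, the curvature depends on the curve only. *)
Definition hcurvature (phi : R -> R) (s : R) : R := Derive phi s + cos (phi s).

Inductive orientation : Set := Positive | Negative.

Definition orientation_sign (o : orientation) : R :=
  match o with Positive => 1 | Negative => -1 end.

Definition orbitlike_elastica (o : orientation) (gamma : hcurve) : Prop :=
  exists phi : R -> R, angle_function gamma phi /\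
  exists k s0 : R, 0 < k < 1 /\
  forall s, hcurvature phi s =
    orientation_sign o * (2 / sqrt (2 - k ^ 2)) *
      dn ((s + s0) / sqrt (2 - k ^ 2)) k.

(* e ^ (i t) *)
Definition expi (t : R) : C := (cos t, sin t).

Definition orbitlike_solution (o : orientation)
    (A1 A2 B1 B2 phiA phiB : R) (gamma : hcurve) (L : R) : Prop :=
  orbitlike_elastica o gamma /\ 0 < L /\
  x1 gamma 0 = A1 /\ x2 gamma 0 = A2 /\
  x1 gamma L = B1 /\ x2 gamma L = B2 /\
  exists phi : R -> R, angle_function gamma phi /\
    expi (phi 0) = expi phiA /\ expi (phi L) = expi phiB.

Definition symmetric_solution (gamma : hcurve) (L : R) : Prop :=
  forall s, 0 <= s <= L / 2 ->
    x1 gamma (L / 2 + s) = - x1 gamma (L / 2 - s) /\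
    x2 gamma (L / 2 + s) = x2 gamma (L / 2 - s).

(* Main.v *)
(** Along an elastica the field [J = (kappa^2 / 2) T + kappa' N] is the restriction
    of a Killing field [a + b z + c z^2] of the half-plane (with [a, b, c] real), and
    [x2 kappa = a + b x1 + c (x1^2 + x2^2)].  Comparing these identities at the two
    endpoints, which are mirror images of each other, shows that either
    [kappa 0 = kappa L] and [kappa' 0 = - kappa' L], or the mean of [kappa 0] and
    [kappa L] is [A2 / A1 * sin phiA + cos phiA].  An orbitlike elastica satisfies
    [0 < |kappa| < 2], so the hypothesis excludes the latter.  Hence the curve and its
    reversed mirror image solve the same initial value problem, and they agree. *)

Require Import Defs.
From Stdlib Require Import Reals Lra Ranalysis5.
From Coquelicot Require Import Coquelicot.
Open Scope R_scope.

(** * Jacobi's amplitude and the differential equation of [dn] *)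

Lemma radicand_bounds (k x : R) :
  0 < k < 1 -> 1 - k ^ 2 <= 1 - k ^ 2 * sin x ^ 2 <= 1.
Proof.
  intros Hk. pose proof (sin2_cos2 x) as H. unfold Rsqr in H.
  assert (0 <= k ^ 2) by apply pow2_ge_0.
  assert (0 <= sin x ^ 2 <= 1) by (pose proof (pow2_ge_0 (cos x)); nra).
  nra.
Qed.

Lemma sqr_lt_1 (k : R) : 0 < k < 1 -> k ^ 2 < 1.
Proof. intros Hk. nra. Qed.

Lemma radicand_pos (k x : R) : 0 < k < 1 -> 0 < 1 - k ^ 2 * sin x ^ 2.
Proof.
  intros Hk. pose proof (radicand_bounds k x Hk). pose proof (sqr_lt_1 k Hk). lra.
Qed.

Lemma sqrt_radicand_bounds (k x : R) :
  0 < k < 1 -> 0 < sqrt (1 - k ^ 2 * sin x ^ 2) <= 1.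
Proof.
  intros Hk. split.
  - apply sqrt_lt_R0, radicand_pos, Hk.
  - rewrite <- sqrt_1 at 2. apply sqrt_le_1_alt, radicand_bounds, Hk.
Qed.

Lemma is_derive_ellF (k x : R) : 0 < k < 1 ->
  is_derive (fun t : R => ellF t k) x (/ sqrt (1 - k ^ 2 * sin x ^ 2)).
Proof.
  intros Hk. unfold ellF.
  assert (Hc : forall t, continuous (fun t => / sqrt (1 - k ^ 2 * sin t ^ 2)) t).
  { intros t. apply (ex_derive_continuous (fun t => / sqrt (1 - k ^ 2 * sin t ^ 2))).
    pose proof (radicand_pos k t Hk). pose proof (sqrt_radicand_bounds k t Hk).
    auto_derive. replace (1 + - _) with (1 - k ^ 2 * sin t ^ 2) by ring.
    repeat split; lra. }
  apply (is_derive_RInt (fun t => / sqrt (1 - k ^ 2 * sin t ^ 2)) _ 0); [|apply Hc].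
  apply filter_forall. intros b.
  apply (RInt_correct (fun t => / sqrt (1 - k ^ 2 * sin t ^ 2))).
  apply (ex_RInt_continuous (fun t => / sqrt (1 - k ^ 2 * sin t ^ 2))).
  intros z _. apply Hc.
Qed.

(** The integrand of [ellF] is at least 1. This one estimate yields injectivity, surjectivity and
    the Lipschitz bound for the inverse. *)
Lemma ellF_expanding (k x y : R) : 0 < k < 1 -> x <= y ->
  y - x <= ellF y k - ellF x k.
Proof.
  intros Hk [Hxy | ->]; [|lra].
  destruct (MVT_cor2 (fun t => ellF t k)
    (fun t => / sqrt (1 - k ^ 2 * sin t ^ 2)) x y Hxy) as [c [-> _]].
  { intros c _. apply is_derive_Reals, is_derive_ellF, Hk. }
  pose proof (sqrt_radicand_bounds k c Hk) as [H0 H1].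
  apply Rinv_le_contravar in H1; [|exact H0]. rewrite Rinv_1 in H1. nra.
Qed.

(** This makes the description in [am] meaningful: by expansion, [ellF] takes the value [u]
    somewhere between [- Rabs u] and [Rabs u], and only once. *)
Lemma ellF_am (u k : R) : 0 < k < 1 -> ellF (am u k) k = u.
Proof.
  intros Hk. unfold am.
  apply (iota_correct (fun x : R => ellF x k = u)).
  assert (E0 : ellF 0 k = 0) by exact (RInt_point 0 _).
  destruct (IVT_gen (fun t => ellF t k) (- Rabs u) (Rabs u) u) as [x [_ Hx]].
  - intros t. apply continuity_pt_filterlim.
    apply (ex_derive_continuous (fun t => ellF t k)).
    eexists. apply is_derive_ellF, Hk.
  - pose proof (Rabs_pos u). pose proof (Rle_abs u). pose proof (Rle_abs (- u)).
    rewrite Rabs_Ropp in *.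
    pose proof (ellF_expanding k 0 (Rabs u) Hk).
    pose proof (ellF_expanding k (- Rabs u) 0 Hk).
    split; [eapply Rle_trans; [apply Rmin_l|lra] | eapply Rle_trans; [|apply Rmax_r]; lra].
  - exists x. split; [exact Hx|]. intros y Hy.
    destruct (Rle_dec x y) as [H|H];
      [pose proof (ellF_expanding k x y Hk) | pose proof (ellF_expanding k y x Hk)]; lra.
Qed.

Lemma am_increasing (k u v : R) : 0 < k < 1 -> u <= v -> 0 <= am v k - am u k <= v - u.
Proof.
  intros Hk Huv. pose proof (ellF_am u k Hk). pose proof (ellF_am v k Hk).
  destruct (Rle_dec (am u k) (am v k)) as [H1|H1].
  - pose proof (ellF_expanding k _ _ Hk H1). lra.
  - pose proof (ellF_expanding k (am v k) (am u k) Hk). lra.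
Qed.

Lemma continuity_am (k u : R) : 0 < k < 1 -> continuity_pt (fun v => am v k) u.
Proof.
  intros Hk eps Heps. exists eps. split; [exact Heps|].
  intros v [_ Hv]. simpl in *. unfold R_dist in *.
  eapply Rle_lt_trans; [|exact Hv].
  destruct (Rle_dec u v) as [H|H].
  - pose proof (am_increasing k u v Hk H). rewrite !Rabs_right; lra.
  - pose proof (am_increasing k v u Hk). rewrite !Rabs_left1; lra.
Qed.

Lemma is_derive_am (k u : R) : 0 < k < 1 -> is_derive (fun v : R => am v k) u (dn u k).
Proof.
  intros Hk. apply is_derive_Reals.
  pose proof (fun a => proj1 (is_derive_Reals _ _ _) (is_derive_ellF k a Hk)) as D.
  assert (Hin : am (u - 1) k <= am u k <= am (u + 1) k).
  { pose proof (am_increasing k (u - 1) u Hk). pose proof (am_increasing k u (u + 1) Hk).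
    lra. }
  pose proof (sqrt_radicand_bounds k (am u k) Hk) as [Hpos _].
  (* The inverse function rule needs some interval with [u] in its interior; the radius 1 is
     arbitrary. *)
  pose proof (derivable_pt_lim_recip_interv (fun t => ellF t k) (fun v => am v k)
    (u - 1) (u + 1) u (fun a _ => exist _ _ (D a)) (continuity_am k u Hk)
    ltac:(lra) ltac:(lra) Hin) as H.
  simpl in H. unfold dn.
  rewrite <- (Rinv_inv (sqrt _)), <- (Rmult_1_l (/ / _)). apply H.
  - intros x _. apply ellF_am, Hk.
  - apply Rinv_neq_0_compat. simpl in Hpos. lra.
Qed.

Lemma is_derive_dn (k u : R) : 0 < k < 1 ->
  is_derive (fun v : R => dn v k) u (- k ^ 2 * (sin (am u k) * cos (am u k))).
Proof.
  intros Hk. pose proof (is_derive_am k u Hk) as Ham.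
  pose proof (radicand_pos k (am u k) Hk) as Hr.
  pose proof (sqrt_radicand_bounds k (am u k) Hk) as [Hs _].
  unfold dn in *. auto_derive; replace (1 + - _) with (1 - k ^ 2 * sin (am u k) ^ 2) by ring.
  - repeat split; [eexists; exact Ham | exact Hr].
  - rewrite (is_derive_unique _ _ _ Ham). field. lra.
Qed.

(** Together with [is_derive_dn] this is the classical equation dn'' = (2 - k^2) dn - 2 dn^3, the
    source of the elastica equation for the curvature. *)
Lemma is_derive_dn_derivative (k u : R) : 0 < k < 1 ->
  is_derive (fun v : R => - k ^ 2 * (sin (am v k) * cos (am v k))) u
    (dn u k * (2 - k ^ 2 - 2 * dn u k ^ 2)).
Proof.
  intros Hk. pose proof (is_derive_am k u Hk) as Ham.
  pose proof (radicand_pos k (am u k) Hk) as Hr.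
  auto_derive.
  - repeat split; eexists; exact Ham.
  - rewrite (is_derive_unique _ _ _ Ham).
    replace (dn u k ^ 2) with (1 - k ^ 2 * sin (am u k) ^ 2)
      by (unfold dn; rewrite pow2_sqrt; lra).
    pose proof (sin2_cos2 (am u k)) as E. unfold Rsqr in E.
    apply Rminus_diag_uniq.
    transitivity (k ^ 2 * dn u k *
      (1 - (sin (am u k) * sin (am u k) + cos (am u k) * cos (am u k)))); [ring|].
    rewrite E. ring.
Qed.

(** * Gronwall's inequality and uniqueness for the elastica system *)

(* The [change] eta-reduces the derivatives that [auto_derive] produces. *)
Ltac rewrite_Derive D :=
  let H := fresh in
  pose proof D as H;
  match type of H with
  | is_derive ?f ?s ?l =>
      change (Derive (fun t : R => f t) s) with (Derive f s);
      rewrite (is_derive_unique f s l H); clear H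
  end.

Lemma is_derive_const_eq (f : R -> R) (a b : R) :
  (forall s, is_derive f s 0) -> f a = f b.
Proof.
  intros H. destruct (MVT_gen f a b (fun _ => 0)) as [c [_ E]].
  - intros s _. apply H.
  - intros s _. apply continuity_pt_filterlim, (ex_derive_continuous f).
    eexists. apply H.
  - lra.
Qed.

(** The product of [E] with exp (- M s) is nonincreasing on the half-line, starts at 0 and stays
    nonnegative. *)
Lemma gronwall_zero (E dE : R -> R) (M : R) :
  (forall s, 0 <= E s) -> (forall s, is_derive E s (dE s)) ->
  (forall s, 0 <= s -> dE s <= M * E s) -> E 0 = 0 -> forall s, 0 <= s -> E s = 0.
Proof.
  intros Hpos HE Hle H0 s [Hs | <-]; [|exact H0].
  destruct (MVT_cor2 (fun t => E t * exp (- M * t))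
    (fun t => (dE t - M * E t) * exp (- M * t)) 0 s Hs) as [c [Hc Hc0]].
  { intros c _. apply is_derive_Reals.
    auto_derive; [eexists; apply HE|].
    rewrite_Derive (HE c). ring. }
  rewrite H0 in Hc. pose proof (exp_pos (- M * c)). pose proof (exp_pos (- M * s)).
  specialize (Hle c ltac:(lra)). specialize (Hpos s).
  assert ((dE c - M * E c) * exp (- M * c) * (s - 0) <= 0) by
    (assert ((dE c - M * E c) * exp (- M * c) <= 0) by nra; nra).
  nra.
Qed.

(** The free elastica equation of the hyperbolic plane, kap'' = kap - kap^3 / 2, written as a
    first-order system together with the equations of the curve. The bound on [kap] makes the cubic
    term Lipschitz. *)
Definition bounded_elastica (x y phi kap dkap : R -> R) : Prop :=
  forall s, 0 < y s /\ Rabs (kap s) <= 2 /\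
    is_derive x s (y s * cos (phi s)) /\
    is_derive y s (y s * sin (phi s)) /\
    is_derive phi s (kap s - cos (phi s)) /\
    is_derive kap s (dkap s) /\
    is_derive dkap s (kap s - kap s ^ 3 / 2).

(** Reflection in the vertical axis and reversal of time each change the sign of the curvature, so
    together they preserve it, while its derivative changes sign. *)
Lemma bounded_elastica_reflect (x y phi kap dkap : R -> R) (L : R) :
  bounded_elastica x y phi kap dkap ->
  bounded_elastica (fun s => - x (L - s)) (fun s => y (L - s))
    (fun s => - phi (L - s)) (fun s => kap (L - s)) (fun s => - dkap (L - s)).
Proof.
  intros H s. destruct (H (L - s)) as (Hy & Hk & Dx & Dy & Dp & Dk & Ddk).
  rewrite cos_neg, sin_neg. unfold Rminus in *.
  refine (conj Hy (conj Hk (conj _ (conj _ (conj _ (conj _ _))))));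
    (auto_derive; [repeat split; eexists; eassumption|]).
  - rewrite_Derive Dx. ring.
  - rewrite_Derive Dy. ring.
  - rewrite_Derive Dp. ring.
  - rewrite_Derive Dk. ring.
  - rewrite_Derive Ddk. ring.
Qed.

Lemma curvature_unique (kap dkap kap' dkap' : R -> R) :
  (forall s, Rabs (kap s) <= 2 /\ is_derive kap s (dkap s) /\
     is_derive dkap s (kap s - kap s ^ 3 / 2)) ->
  (forall s, Rabs (kap' s) <= 2 /\ is_derive kap' s (dkap' s) /\
     is_derive dkap' s (kap' s - kap' s ^ 3 / 2)) ->
  kap 0 = kap' 0 -> dkap 0 = dkap' 0 -> forall s, 0 <= s -> kap s = kap' s.
Proof.
  intros H H' E0 E1 s Hs.
  assert (Z : (kap s - kap' s) ^ 2 + (dkap s - dkap' s) ^ 2 = 0).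
  { refine (gronwall_zero (fun s => (kap s - kap' s) ^ 2 + (dkap s - dkap' s) ^ 2)
      (fun s => 2 * (kap s - kap' s) * (dkap s - dkap' s) +
         2 * (dkap s - dkap' s) *
         ((kap s - kap s ^ 3 / 2) - (kap' s - kap' s ^ 3 / 2))) 8 _ _ _ _ s Hs).
    - intros t. pose proof (pow2_ge_0 (kap t - kap' t)).
      pose proof (pow2_ge_0 (dkap t - dkap' t)). lra.
    - intros t. destruct (H t) as (_ & D1 & D2). destruct (H' t) as (_ & D3 & D4).
      auto_derive; [repeat split; eexists; eassumption|].
      rewrite_Derive D1; rewrite_Derive D2; rewrite_Derive D3; rewrite_Derive D4. field.
    - intros t _. destruct (H t) as (B & _). destruct (H' t) as (B' & _).
      apply Rabs_le_between in B. apply Rabs_le_between in B'.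
      set (a := kap t) in *. set (b := kap' t) in *. set (d := dkap t - dkap' t).
      replace (a - a ^ 3 / 2 - (b - b ^ 3 / 2))
        with ((a - b) * (1 - (a ^ 2 + a * b + b ^ 2) / 2)) by field.
      (* The bound 6 comes from |a|, |b| <= 2. The energy then has derivative 2 (2 - q) e d, at most
         4 (e^2 + d^2), so the constant 8 is ample. *)
      assert (Q : 0 <= (a ^ 2 + a * b + b ^ 2) / 2 <= 6) by (split; nra).
      set (q := (a ^ 2 + a * b + b ^ 2) / 2) in *. clearbody q.
      set (e := a - b). clearbody e d. clear - Q.
      assert (0 <= (e - d) ^ 2) by apply pow2_ge_0.
      assert (0 <= (e + d) ^ 2) by apply pow2_ge_0.
      nra.
    - cbv beta. rewrite E0, E1. ring. }
  pose proof (pow2_ge_0 (dkap s - dkap' s)). nra.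
Qed.

Lemma angle_unique (phi phi' kap kap' : R -> R) :
  (forall s, is_derive phi s (kap s - cos (phi s))) ->
  (forall s, is_derive phi' s (kap' s - cos (phi' s))) ->
  (forall s, 0 <= s -> kap s = kap' s) ->
  cos (phi 0) = cos (phi' 0) -> sin (phi 0) = sin (phi' 0) ->
  forall s, 0 <= s -> cos (phi s) = cos (phi' s) /\ sin (phi s) = sin (phi' s).
Proof.
  intros H H' Hk C0 S0 s Hs.
  (* Angles are compared only modulo 2 pi, so the energy is the squared chord between the points of
     the unit circle at angles [phi s] and [phi' s]. *)
  assert (Z : 2 - 2 * cos (phi s - phi' s) = 0).
  { refine (gronwall_zero (fun s => 2 - 2 * cos (phi s - phi' s))
      (fun s => 2 * sin (phi s - phi' s) *
         ((kap s - cos (phi s)) - (kap' s - cos (phi' s)))) 4 _ _ _ _ s Hs).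
    - intros t. pose proof (COS_bound (phi t - phi' t)). lra.
    - intros t. auto_derive; [repeat split; eexists; [apply H|apply H']|].
      rewrite_Derive (H t); rewrite_Derive (H' t).
      unfold Rminus. ring.
    - intros t Ht. rewrite (Hk t Ht), sin_minus, cos_minus.
      pose proof (sin2_cos2 (phi t)) as E. pose proof (sin2_cos2 (phi' t)) as E'.
      pose proof (COS_bound (phi' t)). pose proof (SIN_bound (phi' t)).
      unfold Rsqr in E, E'.
      set (a := cos (phi t)) in *. set (b := sin (phi t)) in *.
      set (c := cos (phi' t)) in *. set (d := sin (phi' t)) in *.
      replace (2 - 2 * (a * c + b * d)) with ((a - c) ^ 2 + (b - d) ^ 2) by lra.
      replace (b * c - a * d) with ((b - d) * c - (a - c) * d) by ring.
      replace (kap' t - a - (kap' t - c)) with (- (a - c)) by ring.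
      set (P := a - c). set (Q := b - d). clearbody P Q c d.
      pose proof (pow2_ge_0 (P - Q)). pose proof (pow2_ge_0 (P + Q)).
      assert (- (P ^ 2 + Q ^ 2) <= 2 * (P * Q) * c <= P ^ 2 + Q ^ 2) by (split; nra).
      assert (P ^ 2 * d <= P ^ 2) by (pose proof (pow2_ge_0 P); nra).
      pose proof (pow2_ge_0 Q). lra.
    - cbv beta. rewrite cos_minus, C0, S0.
      pose proof (sin2_cos2 (phi' 0)) as E. unfold Rsqr in E. lra. }
  rewrite cos_minus in Z.
  pose proof (sin2_cos2 (phi s)) as E. pose proof (sin2_cos2 (phi' s)) as E'.
  unfold Rsqr in E, E'.
  assert (0 = (cos (phi s) - cos (phi' s)) ^ 2 + (sin (phi s) - sin (phi' s)) ^ 2) by nra.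
  pose proof (pow2_ge_0 (cos (phi s) - cos (phi' s))).
  pose proof (pow2_ge_0 (sin (phi s) - sin (phi' s))).
  split; nra.
Qed.

(** The equation for [y] does not involve [x], so [y] is settled first; then the two derivatives of
    the first coordinate coincide, and the constant 0 suffices. *)
Lemma position_unique (x y phi x' y' phi' : R -> R) :
  (forall s, is_derive x s (y s * cos (phi s)) /\ is_derive y s (y s * sin (phi s))) ->
  (forall s, is_derive x' s (y' s * cos (phi' s)) /\
     is_derive y' s (y' s * sin (phi' s))) ->
  (forall s, 0 <= s -> cos (phi s) = cos (phi' s) /\ sin (phi s) = sin (phi' s)) ->
  x 0 = x' 0 -> y 0 = y' 0 -> forall s, 0 <= s -> x s = x' s /\ y s = y' s.
Proof.
  intros H H' Ha X0 Y0.
  assert (Ey : forall s, 0 <= s -> y s = y' s).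
  { intros s Hs. apply Rminus_diag_uniq, Rsqr_0_uniq.
    refine (gronwall_zero (fun s => Rsqr (y s - y' s))
      (fun s => 2 * (y s - y' s) * (y s * sin (phi s) - y' s * sin (phi' s))) 2
      _ _ _ _ s Hs).
    - intros t. apply Rle_0_sqr.
    - intros t. destruct (H t) as [_ D]. destruct (H' t) as [_ D'].
      unfold Rsqr. auto_derive; [repeat split; eexists; eassumption|].
      rewrite_Derive D; rewrite_Derive D'. ring.
    - intros t Ht. destruct (Ha t Ht) as [_ ->]. pose proof (SIN_bound (phi' t)).
      pose proof (Rle_0_sqr (y t - y' t)). unfold Rsqr in *. nra.
    - cbv beta. rewrite Y0, Rminus_diag. apply Rsqr_0. }
  intros s Hs. split; [|apply Ey, Hs].
  apply Rminus_diag_uniq, Rsqr_0_uniq.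
  refine (gronwall_zero (fun s => Rsqr (x s - x' s))
    (fun s => 2 * (x s - x' s) * (y s * cos (phi s) - y' s * cos (phi' s))) 0
    _ _ _ _ s Hs).
  - intros t. apply Rle_0_sqr.
  - intros t. destruct (H t) as [D _]. destruct (H' t) as [D' _].
    unfold Rsqr. auto_derive; [repeat split; eexists; eassumption|].
    rewrite_Derive D; rewrite_Derive D'. ring.
  - intros t Ht. destruct (Ha t Ht) as [-> _]. rewrite (Ey t Ht). lra.
  - cbv beta. rewrite X0, Rminus_diag. apply Rsqr_0.
Qed.

(** The system is triangular: the curvature evolves on its own, it drives the angle, and the angle
    drives the position. *)
Lemma bounded_elastica_unique (x y phi kap dkap x' y' phi' kap' dkap' : R -> R) :
  bounded_elastica x y phi kap dkap -> bounded_elastica x' y' phi' kap' dkap' ->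
  x 0 = x' 0 -> y 0 = y' 0 ->
  cos (phi 0) = cos (phi' 0) -> sin (phi 0) = sin (phi' 0) ->
  kap 0 = kap' 0 -> dkap 0 = dkap' 0 ->
  forall s, 0 <= s -> x s = x' s /\ y s = y' s.
Proof.
  intros H H' X0 Y0 C0 S0 K0 D0.
  apply (position_unique x y phi x' y' phi'); try assumption;
    [intros s; split; apply H | intros s; split; apply H' |].
  apply (angle_unique phi phi' kap kap'); try assumption;
    [intros s; apply H | intros s; apply H' |].
  apply (curvature_unique kap dkap kap' dkap'); try assumption;
    intros s; refine (conj _ (conj _ _)); solve [apply H | apply H'].
Qed.

(** * The Killing field of an elastica and the symmetry argument *)

(* The first two identities are the components of [J = a + b z + c z^2] at
   [z = x + i y], divided by [y], with the third one substituted in the second. *)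
Lemma killing_field (x y phi kap dkap : R -> R) :
  bounded_elastica x y phi kap dkap ->
  exists a b c : R, forall s,
    sin (phi s) * kap s ^ 2 / 2 + cos (phi s) * dkap s = b + 2 * c * x s /\
    cos (phi s) * kap s ^ 2 / 2 - sin (phi s) * dkap s = kap s - 2 * c * y s /\
    y s * kap s = a + b * x s + c * (x s ^ 2 + y s ^ 2).
Proof.
  intros H.
  pose (S := fun s => sin (phi s) * kap s ^ 2 / 2 + cos (phi s) * dkap s).
  pose (T := fun s => cos (phi s) * kap s ^ 2 / 2 - sin (phi s) * dkap s).
  (* This is the value of c that the second identity forces; the elastica equation makes it
     constant. *)
  pose (C := fun s => (kap s - T s) / (2 * y s)).
  assert (HC : forall s, C s = C 0).
  { intros s. apply is_derive_const_eq. clear s. intros s. unfold C, T.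
    destruct (H s) as (Hy & _ & Dx & Dy & Dp & Dk & Ddk).
    auto_derive; [repeat split; solve [eexists; eassumption | lra]|].
    rewrite_Derive Dy; rewrite_Derive Dp; rewrite_Derive Dk; rewrite_Derive Ddk.
    pose proof (sin2_cos2 (phi s)) as E. unfold Rsqr in E.
    transitivity (dkap s * (1 - (sin (phi s) * sin (phi s) + cos (phi s) * cos (phi s)))
      / (2 * y s)); [field; lra|].
    rewrite E. field. lra. }
  assert (HT : forall s, T s = kap s - 2 * C 0 * y s).
  { intros s. rewrite <- (HC s). unfold C. destruct (H s) as (Hy & _). field. lra. }
  assert (HS : forall s, S s = S 0 - 2 * C 0 * x 0 + 2 * C 0 * x s).
  { intros s.
    (* The derivative of [S] is cos phi (kap - T), which by [HT] is 2 c y cos phi, that is, 2 c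
       x'. *)
    cut (S s - 2 * C 0 * x s = S 0 - 2 * C 0 * x 0); [lra|].
    apply (is_derive_const_eq (fun s => S s - 2 * C 0 * x s)). clear s. intros s.
    destruct (H s) as (Hy & _ & Dx & Dy & Dp & Dk & Ddk).
    specialize (HT s). unfold T in HT.
    unfold S. auto_derive; [repeat split; eexists; eassumption|].
    rewrite_Derive Dx; rewrite_Derive Dp; rewrite_Derive Dk; rewrite_Derive Ddk.
    replace (2 * C 0 * (1 * (y s * cos (phi s)))) with
      (cos (phi s) * (kap s - (cos (phi s) * kap s ^ 2 / 2 - sin (phi s) * dkap s)))
      by (rewrite HT; ring).
    field. }
  set (b := S 0 - 2 * C 0 * x 0) in *.
  set (c := C 0) in *.
  (* The witness for a is read off from the third identity at 0. That identity persists because the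
     derivative of the difference combines the first two, with weights y cos phi and y sin phi. *)
  exists (y 0 * kap 0 - b * x 0 - c * (x 0 ^ 2 + y 0 ^ 2)), b, c.
  intros s. split; [apply HS|]. split; [apply HT|].
  cut (y s * kap s - b * x s - c * (x s ^ 2 + y s ^ 2) =
       y 0 * kap 0 - b * x 0 - c * (x 0 ^ 2 + y 0 ^ 2)); [lra|].
  apply (is_derive_const_eq (fun s => y s * kap s - b * x s - c * (x s ^ 2 + y s ^ 2))).
  clear s. intros s.
  destruct (H s) as (Hy & _ & Dx & Dy & Dp & Dk & Ddk).
  specialize (HT s). specialize (HS s). unfold T in HT. unfold S in HS. clearbody b c.
  auto_derive; [repeat split; eexists; eassumption|].
  rewrite_Derive Dx; rewrite_Derive Dy; rewrite_Derive Dk.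
  pose proof (sin2_cos2 (phi s)) as E. unfold Rsqr in E.
  transitivity (y s * dkap s *
      (1 - (sin (phi s) * sin (phi s) + cos (phi s) * cos (phi s))) +
    y s * cos (phi s) * (sin (phi s) * kap s ^ 2 / 2 + cos (phi s) * dkap s
      - (b + 2 * c * x s)) +
    y s * sin (phi s) * (kap s - 2 * c * y s
      - (cos (phi s) * kap s ^ 2 / 2 - sin (phi s) * dkap s))); [field|].
  rewrite E, HS, HT. ring.
Qed.

Lemma bounded_elastica_symmetric (x y phi kap dkap : R -> R) (L : R) :
  bounded_elastica x y phi kap dkap -> 0 <= L ->
  x 0 <> 0 -> x L = - x 0 -> y L = y 0 ->
  cos (phi L) = cos (phi 0) -> sin (phi L) = - sin (phi 0) ->
  (kap 0 + kap L) / 2 <> y 0 / x 0 * sin (phi 0) + cos (phi 0) ->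
  forall s, 0 <= s <= L -> x s = - x (L - s) /\ y s = y (L - s).
Proof.
  intros H HL Hx XL YL CL SL Hne.
  pose proof (H 0) as [Hy _].
  assert (K : kap L = kap 0 /\ dkap L = - dkap 0).
  { destruct (killing_field _ _ _ _ _ H) as (a & b & c & Q).
    destruct (Q 0) as (S0 & T0 & E0). destruct (Q L) as (S1 & T1 & E1).
    rewrite XL, YL, CL, SL in *. clear Q CL SL XL YL H.
    pose proof (sin2_cos2 (phi 0)) as E. unfold Rsqr in E.
    set (k0 := kap 0) in *. set (k1 := kap L) in *.
    set (d0 := dkap 0) in *. set (d1 := dkap L) in *.
    set (si := sin (phi 0)) in *. set (co := cos (phi 0)) in *.
    set (u := x 0) in *. set (v := y 0) in *.
    clearbody k0 k1 d0 d1 si co u v.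
    (* Both endpoints have the same x^2 + y^2, so subtracting the third identities removes a and c.
       In [G1] (a sum) and [G2] (a difference) c cancels as well. *)
    assert (F : v * (k0 - k1) = 2 * b * u) by lra.
    assert (G1 : si * (k0 ^ 2 - k1 ^ 2) / 2 + co * (d0 + d1) = 2 * b) by lra.
    assert (G2 : co * (k0 ^ 2 - k1 ^ 2) / 2 - si * (d0 + d1) = k0 - k1) by lra.
    (* [G1] and [G2] form a linear system with an orthogonal matrix; [G3] and [G4] are its
       solution. *)
    assert (G3 : (k0 ^ 2 - k1 ^ 2) / 2 = si * (2 * b) + co * (k0 - k1)).
    { rewrite <- G1, <- G2. transitivity ((k0 ^ 2 - k1 ^ 2) / 2 * (si * si + co * co));
        [rewrite E; ring | field]. }
    assert (G4 : d0 + d1 = co * (2 * b) - si * (k0 - k1)).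
    { rewrite <- G1, <- G2. transitivity ((d0 + d1) * (si * si + co * co));
        [rewrite E; ring | field]. }
    replace (2 * b) with (v / u * (k0 - k1)) in G3, G4
      by (apply (Rmult_eq_reg_r u); [rewrite <- F; field |]; assumption).
    assert (k0 - k1 = 0).
    (* [G3] now says that k0 - k1 times this factor is zero, and the hypothesis on the mean
       curvature makes the factor nonzero. [G4] then gives d0 + d1 = 0. *)
    { apply (Rmult_eq_reg_r ((k0 + k1) / 2 - (v / u * si + co))); [|lra]. lra. }
    assert (Z : k0 = k1) by lra. rewrite Z in G4. split; lra. }
  destruct K as [K D].
  intros s [Hs _].
  refine (bounded_elastica_unique _ _ _ _ _ _ _ _ _ _ H
    (bounded_elastica_reflect _ _ _ _ _ L H) _ _ _ _ _ _ s Hs);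
    rewrite Rminus_0_r, ?cos_neg, ?sin_neg; lra.
Qed.

(** * Orbitlike elasticae and the boundary data *)

Lemma is_derive_smooth (f : R -> R) (s : R) : smooth f -> is_derive f s (Derive f s).
Proof. intros H. apply Derive_correct, (H 1%nat). Qed.

Lemma orbitlike_bounded_elastica (o : orientation) (gamma : hcurve) :
  orbitlike_elastica o gamma ->
  exists phi kap dkap : R -> R, angle_function gamma phi /\
    bounded_elastica (x1 gamma) (x2 gamma) phi kap dkap /\
    forall s, 0 < orientation_sign o * kap s < 2.
Proof.
  intros (phi & Hphi & k & s0 & Hk & Hkap).
  set (e := orientation_sign o) in *.
  assert (He : e * e = 1) by (destruct o; unfold e; simpl; lra).
  pose proof (sqr_lt_1 k Hk) as Hk2. pose proof (pow2_ge_0 k) as Hk0.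
  set (r := sqrt (2 - k ^ 2)) in *.
  assert (Hr2 : r * r = 2 - k ^ 2) by (apply sqrt_sqrt; lra).
  (* Since [dn] lies in (0, 1], this strict inequality gives the strict upper bound 2 on the
     absolute curvature. *)
  assert (Hr : 1 < r) by (unfold r; rewrite <- sqrt_1; apply sqrt_lt_1_alt; lra).
  set (kap := fun s => e * (2 / r) * dn ((s + s0) / r) k).
  set (dkap := fun s => e * (2 / r) * (/ r *
    (- k ^ 2 * (sin (am ((s + s0) / r) k) * cos (am ((s + s0) / r) k))))).
  assert (Bk : forall s, 0 < e * kap s < 2).
  { intros s. unfold kap.
    pose proof (sqrt_radicand_bounds k (am ((s + s0) / r) k) Hk) as B.
    fold (dn ((s + s0) / r) k) in B. set (d := dn _ k) in *. clearbody d.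
    replace (e * (e * (2 / r) * d)) with (e * e * (2 * / r * d)) by (unfold Rdiv; ring).
    rewrite He.
    assert (0 < / r < 1) by
      (split; [apply Rinv_0_lt_compat | rewrite <- Rinv_1; apply Rinv_lt_contravar]; lra).
    nra. }
  exists phi, kap, dkap. split; [exact Hphi|]. split; [|exact Bk].
  destruct Hphi as [Sphi Dphi].
  intros s.
  refine (conj (x2_pos gamma s) (conj _ (conj _ (conj _ (conj _ (conj _ _)))))).
  - specialize (Bk s). apply Rabs_le. destruct o; unfold e in Bk; simpl in Bk; lra.
  - rewrite <- (proj1 (Dphi s)). apply is_derive_smooth, x1_smooth.
  - rewrite <- (proj2 (Dphi s)). apply is_derive_smooth, x2_smooth.
  - replace (kap s - cos (phi s)) with (Derive phi s)
      by (specialize (Hkap s); unfold hcurvature in Hkap; unfold kap; lra).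
    apply is_derive_smooth, Sphi.
  - unfold kap, dkap.
    apply (is_derive_scal (fun s => dn ((s + s0) / r) k)).
    apply (is_derive_comp (fun u : R => dn u k) (fun s => (s + s0) / r)).
    + apply is_derive_dn, Hk.
    + auto_derive; [exact I | field; lra].
  - unfold kap, dkap.
    set (u := (s + s0) / r).
    evar_last.
    + apply (is_derive_scal (fun s => / r * (- k ^ 2 *
        (sin (am ((s + s0) / r) k) * cos (am ((s + s0) / r) k))))).
      apply (is_derive_scal (fun s => - k ^ 2 *
        (sin (am ((s + s0) / r) k) * cos (am ((s + s0) / r) k)))).
      apply (is_derive_comp
        (fun v : R => - k ^ 2 * (sin (am v k) * cos (am v k))) (fun s => (s + s0) / r)).
      * apply is_derive_dn_derivative, Hk.
      * auto_derive; [exact I | reflexivity].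
    + fold u. set (d := dn u k). unfold scal; simpl; unfold mult; simpl.
      replace (k * (k * 1)) with (2 - r * r) by (rewrite Hr2; ring).
      transitivity (e * (2 / r) * d - e * (2 / r) * d * (2 * d ^ 2 / r ^ 2)); [field; lra|].
      (* The cube of the curvature carries the cube of the sign [e], which is supplied here through
         e^2 = 1. *)
      transitivity (e * (2 / r) * d - (e * e) * e * (2 / r) * d * (2 * d ^ 2 / r ^ 2));
        [rewrite He; ring | field; lra].
Qed.

Lemma expi_eq (s t : R) : expi s = expi t -> cos s = cos t /\ sin s = sin t.
Proof. intros H. injection H. auto. Qed.

(** The curvature formula and the boundary conditions each come with their own angle function; this
    reconciles them. *)
Lemma angle_function_unique (gamma : hcurve) (phi phi' : R -> R) (s : R) :
  angle_function gamma phi -> angle_function gamma phi' ->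
  cos (phi s) = cos (phi' s) /\ sin (phi s) = sin (phi' s).
Proof.
  intros [_ H] [_ H']. specialize (H s). specialize (H' s).
  pose proof (x2_pos gamma s).
  split; apply (Rmult_eq_reg_l (x2 gamma s)); lra.
Qed.

Lemma cos_sin_opposite_angle (a b : R) (n : Z) :
  a + b = 2 * PI * IZR n -> cos b = cos a /\ sin b = - sin a.
Proof.
  (* Writing 2 pi n as twice n pi lets the double-angle formulas reduce everything to sin (n pi) =
     0, whatever the sign of n. *)
  intros H. replace b with (2 * (IZR n * PI) - a) by lra.
  assert (S : sin (IZR n * PI) = 0) by (apply sin_eq_0_1; exists n; reflexivity).
  rewrite cos_minus, sin_minus, cos_2a_sin, sin_2a, S. split; ring.
Qed.

Lemma orbitlike_solution_symmetric (o : orientation)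
    (A1 A2 B1 B2 phiA phiB : R) (n : Z) (gamma : hcurve) (L : R) :
  A1 = - B1 -> A1 <> 0 -> A2 = B2 -> phiA + phiB = 2 * PI * IZR n ->
  ~ (0 < orientation_sign o * (A2 / A1 * sin phiA + cos phiA) < 2) ->
  orbitlike_solution o A1 A2 B1 B2 phiA phiB gamma L ->
  symmetric_solution gamma L.
Proof.
  intros HB1 HA1 HB2 Hphi Hne (Hel & HL & X0 & Y0 & X1 & Y1 & psi & Hpsi & P0 & P1).
  apply expi_eq in P0 as [C0 S0]. apply expi_eq in P1 as [C1 S1].
  destruct (cos_sin_opposite_angle _ _ _ Hphi) as [CB SB].
  destruct (orbitlike_bounded_elastica o gamma Hel) as (phi & kap & dkap & Ha & Hb & Hk).
  destruct (angle_function_unique gamma phi psi 0 Ha Hpsi) as [c0 s0].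
  destruct (angle_function_unique gamma phi psi L Ha Hpsi) as [c1 s1].
  rewrite C0 in c0. rewrite S0 in s0. rewrite C1, CB in c1. rewrite S1, SB in s1.
  assert (Sym : forall s, 0 <= s <= L ->
    x1 gamma s = - x1 gamma (L - s) /\ x2 gamma s = x2 gamma (L - s)).
  { apply (bounded_elastica_symmetric _ _ phi kap dkap L Hb); rewrite ?X0, ?Y0; try lra.
    (* If the mean of the endpoint curvatures equalled the boundary quantity, then the latter, times
       the orientation sign, would lie in (0, 2). *)
    rewrite c0, s0. intros E. apply Hne. rewrite <- E.
    pose proof (Hk 0). pose proof (Hk L). lra. }
  intros s Hs. replace (L / 2 - s) with (L - (L / 2 + s)) by field.
  apply Sym. lra.
Qed.

Theorem theorem2 (A1 B1 A2 B2 phiA phiB : R)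
    (hA1B1 : A1 = - B1) (hA1 : A1 <> 0)
    (hA2B2 : A2 = B2) (hA2 : 0 < A2)
    (hphi : exists n : Z, phiA + phiB = 2 * PI * IZR n) :
  (~ (0 < A2 / A1 * sin phiA + cos phiA < 2) ->
   forall (gamma : hcurve) (L : R),
     orbitlike_solution Positive A1 A2 B1 B2 phiA phiB gamma L ->
     symmetric_solution gamma L) /\
  (~ (0 < - (A2 / A1 * sin phiA + cos phiA) < 2) ->
   forall (gamma : hcurve) (L : R),
     orbitlike_solution Negative A1 A2 B1 B2 phiA phiB gamma L ->
     symmetric_solution gamma L).
Proof.
  destruct hphi as [n Hn].
  split; intros Hne gamma L; eapply orbitlike_solution_symmetric; eauto; simpl; lra.
Qed.
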